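(* Let $\Pi \in \mathbb{R}^{d\times n}$, and suppose that $\Pi = E\, G_m\, U$ for some (unknown) $m > 0$, $E \in \mathbb{R}^{d\times m}$ and $U \in \{0,1\}^{2^m\times n}$. Suppose $\mathcal{C}(E) \subset \mathcal{B}(0,R)$ for some $R > 0$. Then there exist $E' \in \mathbb{R}^{d\times(m+1)}$ and $U' \in \{0,1\}^{2^{m+1}\times n}$ such that $$\mathcal{C}(E') \subset \mathcal{B}(0,R) \quad\text{and}\quad \Pi = E'\, G_{m+1}\, U',$$ but $$D_{\mathrm{H}}(E,E') = \Omega\left( \frac{R\log d}{\sqrt d\,\log m} \right) \quad \text{if } m \geq 2^d,$$ and $D_{\mathrm{H}}(E,E') = \Omega(R/\sqrt d)$ otherwise.
   Context: For $m \geq 1$ the matrix $G_m \in \{0,1\}^{m\times 2^m}$ is defined by $G_1 = [0\;\;1]$ and, for $m>1$, $$G_m = \begin{bmatrix} \mathbf{0}^\top_{2^{m-1}} & \mathbf{1}^\top_{2^{m-1}} \\ G_{m-1} & G_{m-1} \end{bmatrix},$$ so its columns are all binary vectors of length $m$. The columns of $E$ are edge vectors $y_i x_i$ of examples, the columns of $\Pi$ are rados (each is the sum of a subset of the columns of $E$), and each column of $U$ (resp. $U'$) is a standard basis vector giving the index of the column of $G_m$ (resp. $G_{m+1}$) used for the corresponding rado. $\mathcal{C}(M)$ is the set of column vectors of a matrix $M$; $\mathcal{B}(z,r) = \{x\in\mathbb{R}^d : \|x-z\|_2 < r\}$. For $\mathcal{C}\subseteq\mathbb{R}^d$, $\mathcal{C}\oplus\epsilon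 = \bigcup_{z\in\mathcal{C}}\mathcal{B}(z,\epsilon)$, and the Hausdorff distance is $$D_{\mathrm{H}}(E,E') = \inf\{\epsilon : \mathcal{C}(E)\subseteq\mathcal{C}(E')\oplus\epsilon \ \wedge\ \mathcal{C}(E')\subseteq\mathcal{C}(E)\oplus\epsilon\}.$$ $\Omega$ hides an absolute positive constant. *)

(* Defs.v *)
From mathcomp Require Import all_boot all_order all_algebra.
From mathcomp Require Import all_classical all_reals all_analysis.

Set Implicit Arguments.
Unset Strict Implicit.
Unset Printing Implicit Defensive.

Import Order.TTheory GRing.Theory Num.Theory.

Local Open Scope classical_set_scope.
Local Open Scope ring_scope.

(* The library's norm on matrices is the sup norm, hence a separate
   Euclidean norm. *)
Definition norm2 (R : realType) (d : nat) (x : 'cV[R]_d) : R :=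
  Num.sqrt (\sum_(i < d) x i 0 ^+ 2).

Definition ball2 (R : realType) (d : nat) (z : 'cV[R]_d) (r : R) :
    set 'cV[R]_d :=
  [set x | norm2 (x - z) < r].

Definition columns (R : realType) (d n : nat) (M : 'M[R]_(d, n)) :
    set 'cV[R]_d :=
  range (fun j : 'I_n => col j M).

Definition fatten (R : realType) (d : nat) (C : set 'cV[R]_d) (e : R) :
    set 'cV[R]_d :=
  \bigcup_(z in C) ball2 z e.

(* For matrices with at least one column the set below is nonempty and bounded
   below by 0, so that [inf] is the genuine infimum. *)
Definition hausdorff (R : realType) (d m m' : nat)
    (E : 'M[R]_(d, m)) (E' : 'M[R]_(d, m')) : R :=
  inf [set e : R | columns E `<=` fatten (columns E') e /\
                   columns E' `<=` fatten (columns E) e].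

Lemma expn2S (m : nat) : (2 ^ m + 2 ^ m = 2 ^ m.+1)%N.
Proof. by rewrite addnn -mul2n -expnS. Qed.

(* The recursion starts at the empty 0 x 1 matrix, which makes the case m = 1
   an instance of the block step; see [Gmx1]. *)
Fixpoint Gmx (R : realType) (m : nat) : 'M[R]_(m, 2 ^ m) :=
  match m with
  | 0 => 0
  | m'.+1 =>
      castmx (erefl, expn2S m')
        (col_mx (row_mx (const_mx 0 : 'rV_(2 ^ m')) (const_mx 1 : 'rV_(2 ^ m')))
                (row_mx (Gmx R m') (Gmx R m')))
  end.

Lemma Gmx1 (R : realType) : Gmx R 1 = \row_(j < 2) (j : nat)%:R.
Proof.
apply/matrixP => i j; rewrite castmxE /= !mxE; case: splitP => k _; last by case: k.
rewrite !mxE; case: splitP => l; rewrite !mxE ord1 /=.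
  by move=> ->.
by move=> ->.
Qed.

(* Each column is a standard basis vector; in particular entries are 0 or 1. *)
Definition selection_mx (R : realType) (N n : nat) (U : 'M[R]_(N, n)) : Prop :=
  forall j : 'I_n, exists k : 'I_N, col j U = delta_mx k 0.

(* Main.v *)
Require Import Defs.
From mathcomp Require Import all_boot all_order all_algebra.
From mathcomp Require Import all_classical all_reals all_analysis.
From mathcomp Require Import ring lra.

(* Two ways of building [E'] are used.  If some point [w] of the ball is at
   distance at least [h] from all columns of [E], add [w] as an unused column.
   Otherwise replace the columns in a set [S] by their opposites and add their
   sum: complementing the selection on [S] and selecting the new column gives
   the same rados.  It remains to choose [S] with a sum in the ball and such
   that the flip leaves a hole near a column of [E].

   If [m < 2^d], one of the [2^d] vertices of a cube of half-side
   [r / (2 sqrt d)] is far from all columns, by pigeonhole.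

   Otherwise take [h] of order [r / d], which dominates the required bound since
   [ln m >= d ln 2] and [ln d <= 2 sqrt d].  If no point of the ball is
   [h]-far, consider balls of radius [4h] centred at order [sqrt d] points on
   each half-axis, and let [p] be the centre of one containing the fewest
   columns.  The set [S] consists of the columns in the ball at [p], to be
   cleared, and of columns in the other balls, except that at [-p], chosen to
   balance the former: since the other balls are at least as populated, the
   sum of [S] can be brought into the ball.  The new column can spoil only one
   of two columns found in opposite parts of the hole. *)

Set Implicit Arguments.
Unset Strict Implicit.
Unset Printing Implicit Defensive.

Import Order.TTheory GRing.Theory Num.Theory.

Local Open Scope ring_scope.

(** * Euclidean inner product and norm *)

Definition dot (R : realType) (d : nat) (x y : 'cV[R]_d) : R :=
  \sum_(i < d) x i 0 * y i 0.

Lemma dotC (R : realType) (d : nat) (x y : 'cV[R]_d) : dot x y = dot y x.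
Proof. by apply: eq_bigr => i _; rewrite mulrC. Qed.

Lemma dotDr (R : realType) (d : nat) (x y z : 'cV[R]_d) :
  dot x (y + z) = dot x y + dot x z.
Proof. by rewrite -big_split; apply: eq_bigr => i _; rewrite mxE mulrDr. Qed.

Lemma dotNr (R : realType) (d : nat) (x y : 'cV[R]_d) : dot x (- y) = - dot x y.
Proof. by rewrite -sumrN; apply: eq_bigr => i _; rewrite mxE mulrN. Qed.

Lemma dot_sumr (R : realType) (d : nat) (I : finType) (A : {set I})
    (v : I -> 'cV[R]_d) (x : 'cV[R]_d) :
  dot x (\sum_(i in A) v i) = \sum_(i in A) dot x (v i).
Proof.
rewrite exchange_big; apply: eq_bigr => l _ /=.
by rewrite summxE mulr_sumr.
Qed.

Lemma dot_delta (R : realType) (d : nat) (x : 'cV[R]_d) (a : R) (l : 'I_d) :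
  dot x (a *: delta_mx l 0) = a * x l 0.
Proof.
rewrite /dot (bigD1 l) //= big1 => [|i /negPf il]; last first.
  by rewrite !mxE il mulr0 mulr0.
by rewrite !mxE !eqxx mulr1 addr0 mulrC.
Qed.

Lemma dotxx_ge0 (R : realType) (d : nat) (x : 'cV[R]_d) : 0 <= dot x x.
Proof. by apply: sumr_ge0 => i _; rewrite -expr2 sqr_ge0. Qed.

Lemma norm2E (R : realType) (d : nat) (x : 'cV[R]_d) :
  norm2 x = Num.sqrt (dot x x).
Proof. by congr Num.sqrt; apply: eq_bigr => i _; rewrite expr2. Qed.

Lemma norm2_ge0 (R : realType) (d : nat) (x : 'cV[R]_d) : 0 <= norm2 x.
Proof. exact: sqrtr_ge0. Qed.

Lemma sqr_norm2 (R : realType) (d : nat) (x : 'cV[R]_d) :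
  norm2 x ^+ 2 = dot x x.
Proof. by rewrite norm2E sqr_sqrtr // dotxx_ge0. Qed.

Lemma sqr_norm2D (R : realType) (d : nat) (x y : 'cV[R]_d) :
  norm2 (x + y) ^+ 2 = norm2 x ^+ 2 + 2 * dot x y + norm2 y ^+ 2.
Proof.
by rewrite !sqr_norm2 dotDr (dotC _ x) (dotC _ y) !dotDr (dotC y x); ring.
Qed.

Lemma norm2N (R : realType) (d : nat) (x : 'cV[R]_d) : norm2 (- x) = norm2 x.
Proof. by rewrite !norm2E dotNr dotC dotNr opprK. Qed.

Lemma norm2B (R : realType) (d : nat) (x y : 'cV[R]_d) :
  norm2 (x - y) = norm2 (y - x).
Proof. by rewrite -norm2N opprB. Qed.

(** Cauchy-Schwarz, from the nonnegative squared norm of [dot y y *: x - dot x y *: y]. *)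
Lemma normr_dot (R : realType) (d : nat) (x y : 'cV[R]_d) :
  `|dot x y| <= norm2 x * norm2 y.
Proof.
rewrite -(@ler_pXn2r _ 2) ?nnegrE ?mulr_ge0 ?norm2_ge0 //.
rewrite exprMn !sqr_norm2 real_normK ?num_real //.
have [y0|yn0] := eqVneq (dot y y) 0.
  suff -> : dot x y = 0 by rewrite expr0n /= mulr_ge0 ?dotxx_ge0.
  rewrite /dot big1 // => i _; apply/eqP; rewrite mulf_eq0 orbC -sqrf_eq0 expr2.
  by rewrite (psumr_eq0P _ y0) ?eqxx // => j _; rewrite -expr2 sqr_ge0.
have yp : 0 < dot y y by rewrite lt_def yn0 dotxx_ge0.
have := dotxx_ge0 (dot y y *: x - dot x y *: y).
have -> : dot (dot y y *: x - dot x y *: y) (dot y y *: x - dot x y *: y)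
          = dot y y * (dot x x * dot y y - dot x y ^+ 2).
  have Z (a : R) (u w : 'cV[R]_d) : dot u (a *: w) = a * dot u w.
    by rewrite mulr_sumr; apply: eq_bigr => i _; rewrite mxE; ring.
  rewrite dotDr dotNr 2!Z [X in _ * X - _]dotC [X in _ - _ * X]dotC.
  by rewrite !dotDr !dotNr !Z (dotC y x); ring.
by rewrite pmulr_rge0 // subr_ge0.
Qed.

Lemma ler_norm2D (R : realType) (d : nat) (x y : 'cV[R]_d) :
  norm2 (x + y) <= norm2 x + norm2 y.
Proof.
rewrite -(@ler_pXn2r _ 2) ?nnegrE ?addr_ge0 ?norm2_ge0 //.
rewrite sqr_norm2D sqrrD; have := ler_norm (dot x y); have := normr_dot x y; lra.
Qed.

Lemma ler_dist2 (R : realType) (d : nat) (y x z : 'cV[R]_d) :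
  norm2 (x - z) <= norm2 (x - y) + norm2 (y - z).
Proof. by apply: le_trans (ler_norm2D _ _); rewrite addrA subrK. Qed.

Lemma normr_coord (R : realType) (d : nat) (x : 'cV[R]_d) (l : 'I_d) :
  `|x l 0| <= norm2 x.
Proof.
rewrite -(@ler_pXn2r _ 2) ?nnegrE ?norm2_ge0 // real_normK ?num_real //.
rewrite sqr_norm2 /dot (bigD1 l) //= -expr2 lerDl.
by apply: sumr_ge0 => i _; rewrite -expr2 sqr_ge0.
Qed.

Lemma norm2_delta (R : realType) (d : nat) (a : R) (l : 'I_d) :
  norm2 (a *: delta_mx l 0 : 'cV[R]_d) = `|a|.
Proof. by rewrite norm2E dot_delta !mxE !eqxx mulr1 -expr2 sqrtr_sqr. Qed.

(** * Choosing a set of vectors with small sum *)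

(** If every coordinate failed, summing squares would give $q^2 |s|^2 < d |s|^2$. *)
Lemma large_coord (R : realType) (d q : nat) (s : 'cV[R]_d) :
  (0 < d)%N -> (d <= q ^ 2)%N -> exists l : 'I_d, norm2 s <= q%:R * `|s l 0|.
Proof.
move=> d0 dq; apply: contrapT => /forallNP small.
have qs l : q%:R ^+ 2 * s l 0 ^+ 2 < norm2 s ^+ 2.
  rewrite -[s l 0 ^+ 2]real_normK ?num_real // -exprMn.
  by rewrite ltr_pXn2r ?nnegrE ?mulr_ge0 ?norm2_ge0 // ltNge; apply/negP/small.
have : q%:R ^+ 2 * dot s s < d%:R * norm2 s ^+ 2.
  rewrite mulr_sumr -[X in X%:R * _]card_ord -sumr_const mulr_suml.
  apply: ltr_sum => [|i _]; last by rewrite -expr2 mul1r qs.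
  by apply/hasP; exists (Ordinal d0); rewrite ?mem_index_enum.
rewrite -sqr_norm2 ltNge => /negP; apply; apply: ler_wpM2r; first exact: sqr_ge0.
by rewrite -natrX ler_nat.
Qed.

(* The penalty [\sum_(i in T) norm2 (v i) ^+ 2] absorbs the quadratic error of
   removing a vector, so that removable vectors satisfy an exact inequality. *)
Lemma balanced_subset (R : realType) (d : nat) (I : finType) (A C : {set I})
    (v : I -> 'cV[R]_d) :
  [disjoint A & C] ->
  exists2 T : {set I}, T \subset C &
    let s := \sum_(i in A :|: T) v i in
    [/\ norm2 s ^+ 2 = \sum_(i in A) dot s (v i) + \sum_(i in T) dot s (v i),
        forall f, f \in T -> dot s (v f) <= 0
      & forall f, f \in C -> f \notin T -> - norm2 (v f) ^+ 2 <= dot s (v f)].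
Proof.
move=> dAC.
pose sum (T : {set I}) := \sum_(i in A) v i + \sum_(i in T) v i.
pose Phi T := norm2 (sum T) ^+ 2 + \sum_(i in T) norm2 (v i) ^+ 2.
(* Minimality against deleting [f] from [T] gives the second claim, against adding [f] the third. *)
have [T TC minT] := @arg_minP _ R _ finset.set0 (fun T => T \subset C) Phi (finset.sub0set C).
exists T => //=.
have -> : \sum_(i in A :|: T) v i = sum T.
  by rewrite /sum -bigU ?(disjointWr TC dAC) //; apply: eq_bigl => i; rewrite !inE.
have sumU1 f (T' : {set I}) : f \notin T' -> sum (f |: T') = sum T' + v f.
  by move=> fT'; rewrite /sum big_setU1 //= addrCA addrC.
have Phi1 f (T' : {set I}) : f \notin T' -> Phi (f |: T') - Phi T'
    = 2 * dot (sum T') (v f) + 2 * norm2 (v f) ^+ 2.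
  move=> fT'.
  by rewrite /Phi sumU1 // sqr_norm2D big_setU1 //=; ring.
split=> [|f fT|f fC fT].
- by rewrite sqr_norm2 -!dot_sumr -dotDr.
- have /minT : T :\ f \subset C.
    by apply: fintype.subset_trans TC; exact: finset.subsetDl.
  have := Phi1 f (T :\ f); rewrite setD11 finset.setD1K // => /(_ isT) PhiE.
  have sE : sum T = sum (T :\ f) + v f.
    by rewrite -sumU1 ?finset.setD1K // setD11.
  rewrite sE dotC dotDr (dotC _ (sum _)) -sqr_norm2; lra.
- have /minT : f |: T \subset C by rewrite finset.subUset finset.sub1set fC.
  have := Phi1 f T fT; lra.
Qed.

(* The radii [8h(4q + j)], [j < 4q], lie in [[32qh, 64qh]] and are [8h] apart,
   so that balls of radius [4h] around distinct axis points are disjoint. *)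
Definition axis_radius (R : realType) (q : nat) (h : R) (j : nat) : R :=
  8 * h * (4 * q + j)%:R.

Definition axis_point (R : realType) (d q : nat) (h : R)
    (x : 'I_(4 * q) * 'I_d * bool) : 'cV[R]_d :=
  ((-1) ^+ x.2 * axis_radius q h x.1.1) *: delta_mx x.1.2 0.

Definition antipode (J L : Type) (x : J * L * bool) : J * L * bool :=
  (x.1, ~~ x.2).

Lemma axis_point_antipode (R : realType) (d q : nat) (h : R)
    (x : 'I_(4 * q) * 'I_d * bool) :
  axis_point h (antipode x) = - axis_point h x.
Proof. by rewrite /axis_point /= signrN mulNr scaleNr. Qed.

Lemma axis_radius_bounds (R : realType) (q : nat) (h : R) (j : 'I_(4 * q)) :
  0 < h ->
  32 * q%:R * h <= axis_radius q h j /\ axis_radius q h j <= 64 * q%:R * h.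
Proof.
move=> h0; rewrite /axis_radius natrD natrM.
have : (j%:R : R) <= 4 * q%:R by rewrite -natrM ler_nat ltnW.
by have : 0 <= j%:R :> R by []; nra.
Qed.

Lemma norm2_axis_point (R : realType) (d q : nat) (h : R)
    (x : 'I_(4 * q) * 'I_d * bool) :
  0 < h -> norm2 (axis_point h x) = axis_radius q h x.1.1.
Proof.
move=> h0; rewrite norm2_delta normrMsign ger0_norm //.
by rewrite /axis_radius !mulr_ge0 // ltW.
Qed.

Lemma axis_point_sep (R : realType) (d q : nat) (h : R)
    (x y : 'I_(4 * q) * 'I_d * bool) :
  (0 < q)%N -> 0 < h -> x != y ->
  8 * h <= norm2 (axis_point h x - axis_point h y).
Proof.
(* Compare coordinates on the axis of [x]: distinct axes leave the whole radius of [x], opposite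
   signs add two radii, equal signs leave [8 * h] times the gap between the indices. *)
move=> q0 h0 xy; apply: le_trans (normr_coord _ x.1.2).
have q1 : 1 <= q%:R :> R by rewrite ler1n.
have [rx _] := axis_radius_bounds x.1.1 h0.
have [ry _] := axis_radius_bounds y.1.1 h0.
rewrite !mxE !eqxx mulr1 andbT; case: (x.1.2 =P y.1.2) => [xy2|_]; last first.
  by rewrite mulr0 subr0 normrMsign ger0_norm; nra.
rewrite mulr1; have [b12|b12] := eqVneq x.2 y.2; last first.
  have -> : (-1) ^+ y.2 = - (-1) ^+ x.2 :> R.
    by rewrite -signrN; congr (_ ^+ nat_of_bool _); case: x.2 y.2 b12 => [][].
  by rewrite mulNr opprK -mulrDr normrMsign ger0_norm; nra.
rewrite b12 -mulrBr normrMsign /axis_radius -mulrBr normrM ger0_norm; last lra.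
suff : 1 <= `|(4 * q + x.1.1)%:R - (4 * q + y.1.1)%:R| :> R by nra.
rewrite !natrD opprD addrACA subrr add0r.
have : x.1.1 != y.1.1 :> nat.
  apply: contraNneq xy => /val_inj xy1; apply/eqP.
  rewrite [x]surjective_pairing [x.1]surjective_pairing xy1 xy2 b12.
  by rewrite -!surjective_pairing.
rewrite neq_ltn => /orP[]; rewrite -(ler_nat R) -natr1 => jj.
  by rewrite ler0_norm; lra.
by rewrite ger0_norm; lra.
Qed.

(* If the balanced sum [s] had norm at least [r], every ball lying against [s]
   along its largest coordinate, except the one or two excluded, would be
   entirely selected.  These are at least [3q] balls, each with at least
   [#|N p|] vectors of inner product at most [-28h |s|] with [s]; they outweigh
   [N p], whose vectors have norm at most [68qh], and [|s|^2] would be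
   nonpositive. *)
Lemma balanced_balls (R : realType) (d q : nat) (I : finType)
    (v : I -> 'cV[R]_d) (r h : R)
    (N : 'I_(4 * q) * 'I_d * bool -> {set I}) (p : 'I_(4 * q) * 'I_d * bool) :
  (0 < d)%N -> (d <= q ^ 2)%N -> 0 < h -> 200 * q%:R ^+ 2 * h <= r ->
  (forall x i, i \in N x -> norm2 (v i - axis_point h x) < 4 * h) ->
  (forall x y, x != y -> [disjoint N x & N y]) ->
  (forall x, #|N p| <= #|N x|)%N ->
  exists2 T : {set I},
    (forall i, i \in T -> exists2 x, (x != p) && (x != antipode p) & i \in N x) &
    norm2 (\sum_(i in N p :|: T) v i) < r.
Proof.
move=> d0 dq h0 hr Nh Ndisj Nmin.
have q0 : (0 < q)%N by case: q dq {N p hr Nh Ndisj Nmin} => //; rewrite leqNgt d0.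
have q1 : 1 <= q%:R :> R by rewrite ler1n.
pose C := [set i | [exists x, [&& x != p, x != antipode p & i \in N x]]].
have inC x i : x != p -> x != antipode p -> i \in N x -> i \in C.
  by move=> xp xap ix; rewrite inE; apply/existsP; exists x; rewrite xp xap.
have dAC : [disjoint N p & C].
  rewrite disjoint_subset; apply/fintype.subsetP => i ip; rewrite !inE.
  apply/existsPn => x; apply/negP => /and3P[/Ndisj/disjointFl/(_ ip) + _].
  by move=> ->.
have [T TC [sE sT sC]] := balanced_subset v dAC.
set s := \sum_(i in N p :|: T) v i in sE sT sC.
exists T.
  move=> i /(fintype.subsetP TC); rewrite inE => /existsP[x /and3P[xp xap ix]].
  by exists x; rewrite ?xp.
rewrite -/s ltNge; apply/negP => rs.
have vN x i : i \in N x -> norm2 (v i) <= 68 * q%:R * h.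
  move=> ix; have := ler_norm2D (v i - axis_point h x) (axis_point h x).
  rewrite subrK norm2_axis_point // => vi; have := Nh _ _ ix.
  have := (axis_radius_bounds x.1.1 h0).2; nra.
have [l sl] := large_coord s d0 dq.
(* The sign [b] points against [s]: the centres [(j, l, b)] have inner product at most
   [- (32 * h * norm2 s)] with [s], and the ball radius costs [4 * h * norm2 s], whence the [28]
   below. *)
pose b := 0 < s l 0.
have bs : (-1) ^+ b * s l 0 = - `|s l 0|.
  rewrite /b; case: ltrgt0P => //; rewrite ?mulN1r ?mul1r ?opprK // => ->.
  by rewrite oppr0.
have goodN j i : i \in N (j, l, b) -> dot s (v i) <= - (28 * h * norm2 s).
  move=> ix; rewrite -(subrK (axis_point h (j, l, b)) (v i)) dotDr dot_delta /=.
  rewrite mulrAC bs.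
  have := normr_dot s (v i - axis_point h (j, l, b)).
  have := ler_norm (dot s (v i - axis_point h (j, l, b))).
  have [tj _] := axis_radius_bounds j h0.
  have n4 := Nh _ _ ix; have s0 := norm2_ge0 s.
  have n4s := ler_wpM2l s0 (ltW n4).
  have tjs := ler_wpM2r (normr_ge0 (s l 0)) tj.
  have sl' := ler_wpM2l (ltW h0) sl.
  move: n4s tjs sl'; clear; lra.
(* Dropping one radius index excludes [p] and its antipode at once, whatever their axis, and leaves
   $4q - 1 \geq 3q$ balls. *)
pose F (j : 'I_(4 * q)) := if j == p.1.1 then finset.set0 else N (j, l, b).
(* A vector of [F j] outside [T] would have inner product at least $-(68qh)^2 = -4624 q^2 h^2$ with
   [s], but it is at most $-28h \cdot 200 q^2 h = -5600 q^2 h^2$. *)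
have FT : \bigcup_j F j \subset T.
  apply/bigcupsP => j _; rewrite /F; case: eqP => [_|/eqP jp].
    exact: finset.sub0set.
  apply/fintype.subsetP => i ix; apply/negPn/negP => iT.
  have neqs y : y.1.1 = p.1.1 -> (j, l, b) != y.
    by move=> y1; apply: contraNneq jp => jy; rewrite -y1 -jy.
  have := sC i (inC _ _ (neqs p erefl) (neqs (antipode p) erefl) ix) iT.
  have gi := goodN _ _ ix.
  apply/negP; rewrite -ltNge; apply: le_lt_trans gi _; rewrite ltrN2.
  have vi2 : norm2 (v i) ^+ 2 <= (68 * q%:R * h) ^+ 2.
    by rewrite ler_pXn2r ?nnegrE ?norm2_ge0 ?(vN _ _ ix) // !mulr_ge0 // ltW.
  have hrs := ler_wpM2l (ltW h0) (le_trans hr rs).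
  have : 0 < q%:R ^+ 2 * h ^+ 2 by rewrite mulr_gt0 ?exprn_gt0 ?ltr0n.
  move: vi2 hrs; clear; lra.
have Fdisj i j : i != j -> [disjoint F i & F j].
  move=> ij; rewrite /F; case: eqP => _; first by rewrite -setI_eq0 finset.set0I.
  case: eqP => _; first by rewrite -setI_eq0 finset.setI0.
  by apply: Ndisj; apply: contraNneq ij => -[->].
have Tle : \sum_(i in T) dot s (v i)
    <= - (3 * q%:R * #|N p|%:R * (28 * h * norm2 s)).
  rewrite (big_setID (\bigcup_j F j)) /= (finset.setIidPr FT).
  apply: (@le_trans _ _ (\sum_(i in \bigcup_j F j) dot s (v i))).
    by rewrite gerDl; apply: sumr_le0 => i /setDP[/sT].
  rewrite partition_disjoint_bigcup // (bigD1 p.1.1) //=.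
  rewrite {1}/F eqxx big_set0 add0r.
  apply: (@le_trans _ _ (\sum_(j | j != p.1.1)
            - (#|N p|%:R * (28 * h * norm2 s)))).
    apply: ler_sum => j /negPf jp; rewrite /F jp.
    apply: (@le_trans _ _ (\sum_(i in N (j, l, b)) - (28 * h * norm2 s))).
      by apply: ler_sum => i; exact: goodN.
    rewrite sumr_const mulNrn lerN2 -[leRHS]mulr_natl ler_wpM2r ?ler_nat //.
    by rewrite !mulr_ge0 ?norm2_ge0 ?ler0n // ltW.
  rewrite sumr_const cardC1 card_ord.
  rewrite mulNrn lerN2 -mulrA -[leRHS]mulr_natl; apply: ler_wpM2r.
    by rewrite !mulr_ge0 ?norm2_ge0 ?ler0n // ltW.
  rewrite -natrM ler_nat -ltnS prednK ?muln_gt0 //.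
  by rewrite ltn_pmul2r.
have Ale : \sum_(i in N p) dot s (v i) <= #|N p|%:R * (norm2 s * (68 * q%:R * h)).
  rewrite mulr_natl -sumr_const; apply: ler_sum => i ip.
  apply: le_trans (ler_norm _) _; apply: le_trans (normr_dot _ _) _.
  by rewrite ler_wpM2l ?norm2_ge0 // (vN p).
have r0 : 0 < r by apply: lt_le_trans hr; rewrite !mulr_gt0 ?exprn_gt0 ?ltr0n.
(* The selected balls outweigh [N p] because $3 \cdot 28 = 84 > 68$. *)
have : 0 < norm2 s ^+ 2 by rewrite exprn_gt0 // (lt_le_trans r0).
have : 0 <= #|N p|%:R * (norm2 s * (q%:R * h)).
  by rewrite !mulr_ge0 ?norm2_ge0 ?ler0n // ltW.
by move: sE Tle Ale; clear; lra.
Qed.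

(** The vector [v a] is taken within [3 * h] of the centre [p]. Unflipped vectors lie outside the
    ball of radius [4 * h] at [p] since [S] contains [N p], and flipped ones do too since [S] avoids
    the antipodal ball. *)
Lemma flip_set (R : realType) (d q m : nat) (v : 'I_m -> 'cV[R]_d) (r h : R) :
  (0 < d)%N -> (d <= q ^ 2)%N -> 0 < h -> 200 * q%:R ^+ 2 * h <= r ->
  (forall x, norm2 x < r -> exists i, norm2 (v i - x) < h) ->
  exists (S : {set 'I_m}) (a : 'I_m),
    [/\ norm2 (\sum_(i in S) v i) < r,
        h <= norm2 (\sum_(i in S) v i - v a),
        forall i, i \in S -> h <= norm2 (- v i - v a)
      & forall i, i \notin S -> h <= norm2 (v i - v a)].
Proof.
move=> d0 dq h0 hr net.
have q0 : (0 < q)%N by case: q dq {hr} => //; rewrite leqNgt d0.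
pose N (x : 'I_(4 * q) * 'I_d * bool) :=
  [set i | norm2 (v i - axis_point h x) < 4 * h].
have J0 : (0 < 4 * q)%N by rewrite muln_gt0.
pose x0 := (Ordinal J0, Ordinal d0, true).
have [p _ Nmin] := @arg_minnP _ x0 xpredT (fun x => #|N x|) isT.
have Ndisj x y : x != y -> [disjoint N x & N y].
  move=> xy; rewrite disjoint_subset; apply/fintype.subsetP => i.
  rewrite !inE -leNgt => ix; have := axis_point_sep q0 h0 xy.
  have := ler_dist2 (v i) (axis_point h x) (axis_point h y).
  by rewrite (norm2B _ (v i)); move: ix; clear; lra.
have Nh x i : i \in N x -> norm2 (v i - axis_point h x) < 4 * h.
  by rewrite inE.
have [T TN sr] := balanced_balls d0 dq h0 hr Nh Ndisj (fun x => Nmin x isT).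
pose S := N p :|: T; set s := \sum_(i in _) v i in sr.
(* A vector within [h] of either of these two points is within [3 * h] of the centre. *)
pose y (b : bool) : 'cV[R]_d :=
  axis_point h p + ((-1) ^+ b * (2 * h)) *: delta_mx p.1.2 0.
have yp b : norm2 (y b - axis_point h p) = 2 * h.
  by rewrite /y addrC addKr norm2_delta normrMsign ger0_norm // mulr_ge0 // ltW.
have yr b : norm2 (y b) < r.
  apply: lt_le_trans hr; apply: le_lt_trans (ler_norm2D _ _) _.
  rewrite norm2_axis_point // norm2_delta normrMsign ger0_norm; last lra.
  have [_] := axis_radius_bounds p.1.1 h0.
  have q1 : 1 <= q%:R :> R by rewrite ler1n.
  have qh := ler_wpM2r (ltW h0) q1.
  have := ler_wpM2l (le_trans ler01 q1) qh.
  by move: h0 qh; clear; lra.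
have netp b : exists2 a, norm2 (v a - axis_point h p) < 3 * h
    & norm2 (v a - y b) < h.
  have [a ay] := net _ (yr b); exists a => //.
  by have := ler_dist2 (y b) (v a) (axis_point h p); rewrite yp; lra.
(* The two points are [4 * h] apart, so [s] cannot be within [h] of a vector near each. *)
have [a ap sa] : exists2 a, norm2 (v a - axis_point h p) < 3 * h
    & h <= norm2 (s - v a).
  have [a ap ay] := netp true; have [b bp bY] := netp false.
  have [sa|sa] := leP h (norm2 (s - v a)); first by exists a.
  exists b => //.
  have yy : norm2 (y true - y false) = 4 * h.
    rewrite /y opprD addrACA subrr add0r -scalerBl norm2_delta expr0 expr1.
    by rewrite ler0_norm; lra.
  have := ler_dist2 (v a) (y true) (y false).
  have := ler_dist2 s (v a) (y false); have := ler_dist2 (v b) s (y false).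
  rewrite yy (norm2B (y true)) (norm2B (v a) s).
  by move: ay sa bY; clear; lra.
have Sant i : i \in S -> i \notin N (antipode p).
  have dis x : x != antipode p -> i \in N x -> i \notin N (antipode p).
    by move=> /Ndisj/disjointFr/[apply] ->.
  rewrite finset.in_setU => /orP[|/TN[x /andP[_]]]; last exact: dis.
  apply: dis; apply/eqP => /(congr1 snd) /=.
  by case: p.2.
exists S, a; split=> // i iS.
  have := Sant i iS; rewrite inE -leNgt axis_point_antipode opprK.
  have := ler_dist2 (v a) (- v i) (axis_point h p).
  rewrite -(norm2N (v i + _)) opprD.
  by move: ap; clear; lra.
have : i \notin N p by apply: contra iS; rewrite finset.in_setU => ->.
rewrite inE -leNgt; have := ler_dist2 (v a) (v i) (axis_point h p).
by move: ap; clear; lra.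
Qed.

(** * Few columns: pigeonhole on the vertices of a cube *)

(** The vertices have norm [r / 2]. Two of them differ by a full side in some coordinate, so no
    column is closer than the half-side to both. *)
Lemma cube_far (R : realType) (d m : nat) (v : 'I_m -> 'cV[R]_d) (r : R) :
  (0 < d)%N -> 0 < r -> (m < 2 ^ d)%N ->
  exists2 x, norm2 x < r & forall i, r / (2 * Num.sqrt d%:R) <= norm2 (x - v i).
Proof.
move=> d0 r0 md; have u0 : 0 < Num.sqrt d%:R :> R by rewrite sqrtr_gt0 ltr0n.
set a := r / _; have a0 : 0 < a by rewrite divr_gt0 // mulr_gt0.
pose y (f : {ffun 'I_d -> bool}) : 'cV[R]_d := \col_l ((-1) ^+ f l * a).
have yr f : norm2 (y f) < r.
  rewrite /norm2 (eq_bigr (fun=> a ^+ 2)) => [|l _]; last first.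
    by rewrite mxE exprMn sqrr_sign mul1r.
  rewrite sumr_const card_ord -[_ *+ d]mulr_natr sqrtrM ?sqr_ge0 //.
  rewrite sqrtr_sqr gtr0_norm // /a invfM mulrA mulfVK ?gt_eqF //.
  by rewrite ltr_pdivrMr // ltr_pMr // ltr1n.
apply: contrapT => /forall2NP near.
have /choice[g gy] f : exists i, norm2 (y f - v i) < a.
  have [/negP|/existsNP[i /negP]] := near (y f); first by rewrite yr.
  by rewrite -ltNge; exists i.
have ginj : injective g.
  move=> f f' gff'; apply/ffunP => l; apply: contrapT => /eqP ll.
  have := normr_coord (y f - y f') l.
  have := ler_dist2 (v (g f)) (y f) (y f'); have := gy f.
  have := gy f'; rewrite norm2B -gff' !mxE.
  have -> : (-1) ^+ f' l = - (-1) ^+ f l :> R.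
    by rewrite -signrN; congr (_ ^+ nat_of_bool _); case: (f l) (f' l) ll => [][].
  rewrite mulNr opprK -mulrDr normrMsign ger0_norm; last lra.
  lra.
by have := leq_card g ginj; rewrite card_ffun card_bool !card_ord leqNgt md.
Qed.

(** * Columns of [Gmx] as indicator vectors of subsets *)

Lemma col_GmxS (R : realType) (m : nat) (k : 'I_(2 ^ m)) (b : bool) :
  col (cast_ord (expn2S m) (if b then rshift _ k else lshift _ k)) (Gmx R m.+1)
  = col_mx (const_mx b%:R) (col k (Gmx R m)) :> 'cV_(1 + m).
Proof.
apply/matrixP => i j; rewrite mxE castmxE cast_ord_id cast_ordK.
by case: (split_ordP (i : 'I_(1 + m))) => l ->; rewrite ?col_mxEu ?col_mxEd;
  case: b; rewrite ?row_mxEl ?row_mxEr !mxE.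
Qed.

Lemma Gmx01 (R : realType) (m : nat) (i : 'I_m) (k : 'I_(2 ^ m)) :
  exists b : bool, Gmx R m i k = b%:R.
Proof.
elim: m i k => [[]//|m IHm] i k; rewrite castmxE mxE.
case: splitP => l _; rewrite mxE; case: splitP => o _; rewrite ?mxE.
- by exists false.
- by exists true.
- exact: IHm.
- exact: IHm.
Qed.

Lemma Gmx_surj (R : realType) (m : nat) (x : 'I_m -> bool) :
  exists k, col k (Gmx R m) = \col_i (x i)%:R.
Proof.
elim: m x => [|m IHm] x; first by exists ord0; apply/matrixP => -[].
have [k xk] := IHm (fun i => x (lift ord0 i)).
exists (cast_ord (expn2S m) (if x ord0 then rshift _ k else lshift _ k)).
rewrite col_GmxS xk; apply/matrixP => i j; rewrite !mxE.
case: splitP => l il; rewrite !mxE; congr (x _)%:R; apply: val_inj.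
  by rewrite /= il ord1.
by rewrite /= il.
Qed.

(** The columns of [Gmx] are exactly the 0/1 vectors, so each rado is a subset sum of columns of
    [E], and it suffices to rewrite subset sums. *)
Lemma rado_transfer (R : realType) (d n m m' : nat) (E : 'M[R]_(d, m))
    (E' : 'M[R]_(d, m')) (U : 'M[R]_(2 ^ m, n)) :
  selection_mx U ->
  (forall x : 'I_m -> bool, exists x' : 'I_m' -> bool,
     E *m (\col_i (x i)%:R) = E' *m (\col_i (x' i)%:R)) ->
  exists2 U' : 'M[R]_(2 ^ m', n), selection_mx U' &
    E *m Gmx R m *m U = E' *m Gmx R m' *m U'.
Proof.
move=> selU EE'.
have colM p o (M : 'M[R]_(d, p)) (N : 'M[R]_(p, o)) j :
  col j (M *m N) = M *m col j N by rewrite !colE mulmxA.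
have step j : exists k', col j (E *m Gmx R m *m U) = E' *m col k' (Gmx R m').
  have [k Uk] := selU j.
  have /choice[x xE] := fun i => @Gmx01 R m i k.
  have [x' x'E] := EE' x; have [k' k'E] := Gmx_surj R x'.
  exists k'; rewrite k'E -x'E colM Uk -mulmxA -colE; congr (E *m _).
  by apply/matrixP => i o; rewrite !mxE xE.
have [f fE] := choice step.
have U'E j : col j (\matrix_(i < 2 ^ m', j < n) (i == f j)%:R : 'M[R]_(2 ^ m', n))
    = delta_mx (f j) 0.
  by apply/matrixP => i o; rewrite !mxE ord1 eqxx andbT.
exists (\matrix_(i < 2 ^ m', j < n) (i == f j)%:R); first by move=> j; exists (f j).
apply/matrixP => i j; have /matrixP/(_ i 0) := fE j; rewrite mxE => ->.
have -> : forall M : 'M[R]_(d, n), M i j = col j M i 0 by move=> M; rewrite mxE.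
by rewrite colM U'E -mulmxA -colE.
Qed.

(** * Hausdorff distance and the modified matrix *)

Local Open Scope classical_set_scope.
Local Open Scope ring_scope.

(** A far column, of either matrix, bounds every admissible [e] from below through one of the two
    inclusions. *)
Lemma le_hausdorff (R : realType) (d m m' : nat) (E : 'M[R]_(d, m))
    (E' : 'M[R]_(d, m')) (r h : R) :
  (0 < m)%N -> (0 < m')%N ->
  columns E `<=` ball2 0 r -> columns E' `<=` ball2 0 r ->
  (exists j, forall i, h <= norm2 (col j E' - col i E)) \/
  (exists i, forall j, h <= norm2 (col j E' - col i E)) ->
  h <= hausdorff E E'.
Proof.
move=> m0 m'0 Er E'r far; apply: lb_le_inf.
  have colr n (M : 'M[R]_(d, n)) : columns M `<=` ball2 0 r ->
      forall j, norm2 (col j M) < r.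
    by move=> Mr j; have := Mr _ (imageT _ j); rewrite /ball2 /= subr0.
  have dist i j : norm2 (col i E - col j E') < r + r.
    apply: le_lt_trans (ler_norm2D _ _) _; rewrite norm2N.
    by apply: ltrD; apply: colr.
  (* The ball hypotheses serve to exhibit an admissible value, as [lb_le_inf] requires a nonempty
     set. *)
  exists (r + r); split=> _ [i _ <-].
    by exists (col (Ordinal m'0) E'); [exists (Ordinal m'0)|exact: dist].
  exists (col (Ordinal m0) E); first by exists (Ordinal m0).
  by rewrite /ball2 /= norm2B; exact: dist.
move=> e [EE' E'E]; case: far => -[j far].
  have [_ [i _ <-] /ltW] := E'E _ (imageT _ j).
  exact: le_trans (far i).
have [_ [i _ <-] /ltW] := EE' _ (imageT _ j).
by rewrite norm2B; apply: le_trans (far i).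
Qed.

(** The new column comes first, so that old columns sit at [lift ord0 j]; an empty [S] gives the
    construction without flips. *)
Definition reflect_cols (R : realType) (d m : nat) (E : 'M[R]_(d, m))
    (S : {set 'I_m}) (w : 'cV[R]_d) : 'M[R]_(d, m.+1) :=
  (row_mx w (\matrix_(i, j) ((-1) ^+ (j \in S) * E i j)) : 'M[R]_(d, 1 + m)).

Lemma col0_reflect_cols (R : realType) (d m : nat) (E : 'M[R]_(d, m))
    (S : {set 'I_m}) (w : 'cV[R]_d) :
  col ord0 (reflect_cols E S w) = w.
Proof.
apply/matrixP => i j; rewrite !mxE ord1.
have -> : ord0 = lshift m ord0 :> 'I_(1 + m) by exact: val_inj.
by rewrite (unsplitK (inl ord0)).
Qed.

Lemma colS_reflect_cols (R : realType) (d m : nat) (E : 'M[R]_(d, m))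
    (S : {set 'I_m}) (w : 'cV[R]_d) (j : 'I_m) :
  col (lift ord0 j) (reflect_cols E S w) = (-1) ^+ (j \in S) *: col j E.
Proof.
apply/matrixP => i k; rewrite !mxE.
have -> : lift ord0 j = rshift 1 j :> 'I_(1 + m) by exact: val_inj.
by rewrite (unsplitK (inr j)) mxE.
Qed.

(* If [w] is the sum of the columns in [S], then complementing the selection
   on [S] and selecting [w] leaves the selected sum unchanged. *)
Lemma reflect_cols_sum (R : realType) (d m : nat) (E : 'M[R]_(d, m))
    (S : {set 'I_m}) (w : 'cV[R]_d) (b : bool) (x : 'I_m -> bool) :
  (if b then w = \sum_(j in S) col j E else S = finset.set0) ->
  exists x' : 'I_m.+1 -> bool,
    E *m (\col_i (x i)%:R) = reflect_cols E S w *m (\col_i (x' i)%:R).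
Proof.
move=> wS.
exists (fun k => if unlift ord0 k is Some i then (i \in S) (+) x i else b).
apply/matrixP => i o; rewrite !mxE big_ord_recl.
have -> : reflect_cols E S w i ord0 = w i 0.
  by have /matrixP/(_ i 0) := col0_reflect_cols E S w; rewrite mxE.
rewrite mxE unlift_none.
(* For [b = false] both sides vanish, [S] being empty. *)
have -> : w i 0 * b%:R = \sum_j if j \in S then E i j else 0.
  case: b wS => wS; last first.
    by rewrite mulr0 big1 // => j _; rewrite wS finset.in_set0.
  rewrite mulr1 wS summxE [LHS]big_mkcond; apply: eq_bigr => j _.
  by rewrite mxE.
rewrite -big_split; apply: eq_bigr => j _ /=.
have -> : reflect_cols E S w i (lift ord0 j) = (-1) ^+ (j \in S) * E i j.
  by have /matrixP/(_ i 0) := colS_reflect_cols E S w j; rewrite !mxE.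
by rewrite !mxE liftK; case: (j \in S) (x j) => [][] /=; ring.
Qed.

Lemma reflect_hausdorff (R : realType) (d n m : nat) (E : 'M[R]_(d, m))
    (U : 'M[R]_(2 ^ m, n)) (r h : R) (S : {set 'I_m}) (w : 'cV[R]_d) (b : bool) :
  (0 < m)%N -> selection_mx U -> columns E `<=` ball2 0 r -> norm2 w < r ->
  (if b then w = \sum_(j in S) col j E else S = finset.set0) ->
  (forall i, h <= norm2 (w - col i E)) \/
  (exists a, h <= norm2 (w - col a E) /\
     forall i, h <= norm2 ((-1) ^+ (i \in S) *: col i E - col a E)) ->
  exists (E' : 'M[R]_(d, m.+1)) (U' : 'M[R]_(2 ^ m.+1, n)),
    [/\ selection_mx U', columns E' `<=` ball2 0 r,
        E *m Gmx R m *m U = E' *m Gmx R m.+1 *m U'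
      & h <= hausdorff E E'].
Proof.
move=> m0 selU Er wr wS far; exists (reflect_cols E S w).
have [U' selU' UE] := rado_transfer selU (fun x => reflect_cols_sum x wS).
have E'r : columns (reflect_cols E S w) `<=` ball2 0 r.
  move=> _ [j _ <-]; rewrite /ball2 /= subr0.
  case: (unliftP ord0 j) => [k ->|->]; last by rewrite col0_reflect_cols.
  rewrite colS_reflect_cols.
  have := Er _ (imageT _ k); rewrite /ball2 /= subr0.
  by case: (k \in S); rewrite ?scaleN1r ?norm2N ?scale1r.
exists U'; split=> //.
apply: (@le_hausdorff _ _ _ _ _ _ r) => //.
case: far => [far|[a [wa far]]]; [left; exists ord0 => i|right; exists a => j].
  by rewrite col0_reflect_cols.
case: (unliftP ord0 j) => [k ->|->]; last by rewrite col0_reflect_cols.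
by rewrite colS_reflect_cols.
Qed.

(** * Numerical rates and the final case split *)

(** An integer of order $\sqrt d$ is needed to count radii. The least [q] with $d \leq q^2$ works:
    $(q-1)^2 < d$, and $q \leq 2(q-1)$ once $q \geq 2$. *)
Lemma ceil_sqrt (d : nat) :
  (0 < d)%N -> exists q, [/\ (0 < q)%N, (d <= q ^ 2)%N & (q ^ 2 <= 4 * d)%N].
Proof.
move=> d0; have ex : exists q, (d <= q ^ 2)%N.
  by exists d; rewrite expnS expn1 leq_pmulr.
case: (ex_minnP ex) => -[|[|q]] dq minq; first by rewrite leqNgt d0 in dq.
  by exists 1%N; split=> //; rewrite muln_gt0.
exists q.+2; split=> //.
have qd : (q.+1 ^ 2 < d)%N.
  by rewrite ltnNge; apply/negP => /minq; rewrite ltnn.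
apply: (@leq_trans (4 * q.+1 ^ 2)); last by rewrite leq_mul2l ltnW.
by rewrite -[4%N]/(2 ^ 2)%N -expnMn leq_exp2r // mul2n -addnn addSnnS leq_addl.
Qed.

(** With $u = \sqrt d$, combine $\ln d \leq 2u$, $q^2 \leq 4u^2$ and $u^2 \ln 2 \leq \ln m$; the
    constant is $1600 = 200 \cdot 2 \cdot 4$. *)
Lemma ln_rate (R : realType) (d q m : nat) (r : R) :
  (0 < d)%N -> (0 < q)%N -> (q ^ 2 <= 4 * d)%N -> (2 ^ d <= m)%N -> 0 < r ->
  ln 2 / 1600 * (r * ln d%:R / (Num.sqrt d%:R * ln m%:R))
    <= r / (200 * q%:R ^+ 2).
Proof.
move=> d0 q0 qd dm r0.
have l2 : 0 < ln 2 :> R by rewrite ln_gt0 // ltr1n.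
have dR : 0 < d%:R :> R by rewrite ltr0n.
have qR : 0 < q%:R ^+ 2 :> R by rewrite exprn_gt0 // ltr0n.
set u := Num.sqrt _; have u0 : 0 < u by rewrite sqrtr_gt0.
have u2 : u ^+ 2 = d%:R by rewrite sqr_sqrtr // ltW.
have lnd : ln d%:R <= 2 * u.
  rewrite -u2 lnXn // -[_ *+ 2]mulr_natl ler_wpM2l //.
  exact/ltW/ln_sublinear.
have lnm : d%:R * ln 2 <= ln m%:R :> R.
  rewrite mulr_natl -lnXn // ler_ln ?posrE ?exprn_gt0 // -?natrX ?ler_nat //.
  by rewrite ltr0n (leq_trans _ dm) // expn_gt0.
have lnm0 : 0 < ln m%:R :> R by apply: lt_le_trans lnm; rewrite mulr_gt0.
have q4 : q%:R ^+ 2 <= 4 * u ^+ 2 by rewrite u2 -natrX -natrM ler_nat.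
have um0 : 0 < u * ln m%:R by rewrite mulr_gt0.
have Q0 : 0 < 200 * q%:R ^+ 2 :> R by rewrite mulr_gt0 ?ltr0n.
rewrite [leLHS]mulrA (ler_pdivrMr _ _ um0) [leRHS]mulrAC (ler_pdivlMr _ _ Q0).
have lnd0 : 0 <= ln d%:R :> R by rewrite ln_ge0 // ler1n.
have step1 : ln d%:R * q%:R ^+ 2 <= (2 * u) * (4 * u ^+ 2).
  by apply: ler_pM; rewrite ?lnd0 ?lnd ?q4 // ltW.
have step2 : u * (d%:R * ln 2) <= u * ln m%:R by rewrite ler_wpM2l // ltW.
have rstep1 := ler_wpM2l (ltW (mulr_gt0 l2 r0)) step1.
have rstep2 := ler_wpM2l (ltW r0) step2; rewrite -u2 in rstep2.
by move: rstep1 rstep2; clear; lra.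
Qed.

Theorem lemma10 (R : realType) :
  exists2 c : R, 0 < c &
    forall (d n m : nat) (Pi : 'M[R]_(d, n)) (E : 'M[R]_(d, m))
           (U : 'M[R]_(2 ^ m, n)) (r : R),
      (0 < d)%N -> (0 < m)%N -> 0 < r ->
      selection_mx U ->
      Pi = E *m Gmx R m *m U ->
      columns E `<=` ball2 0 r ->
      exists (E' : 'M[R]_(d, m.+1)) (U' : 'M[R]_(2 ^ m.+1, n)),
        [/\ selection_mx U',
            columns E' `<=` ball2 0 r,
            Pi = E' *m Gmx R m.+1 *m U',
            (2 ^ d <= m)%N ->
              c * (r * ln d%:R / (Num.sqrt d%:R * ln m%:R)) <= hausdorff E E'
          & (m < 2 ^ d)%N ->
              c * (r / Num.sqrt d%:R) <= hausdorff E E'].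
Proof.
have l2 : 0 < ln 2 :> R by rewrite ln_gt0 // ltr1n.
(* This is the constant of [ln_rate]; few columns only require it to be at most $1/2$, which follows
   from $\ln 2 < 2$. *)
exists (ln 2 / 1600); first by rewrite divr_gt0 ?ltr0n.
move=> d n m Pi E U r d0 m0 r0 selU -> Er.
have [md|dm] := ltnP m (2 ^ d).
  have [w wr wE] := cube_far (fun j => col j E) d0 r0 md.
  have [E' [U' [selU' E'r EE' hE]]] :=
    reflect_hausdorff (S := finset.set0) (b := false) m0 selU Er wr erefl
      (or_introl wE).
  exists E', U'; split=> // _; apply: le_trans hE.
  have u0 : 0 < Num.sqrt d%:R :> R by rewrite sqrtr_gt0 ltr0n.
  rewrite [leRHS](_ : _ = 2^-1 * (r / Num.sqrt d%:R)); last first.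
    by rewrite invfM mulrCA.
  apply: ler_wpM2r; first by rewrite ltW // divr_gt0.
  have := @ln_sublinear R 2 (ltr0n _ 2); lra.
have [q [q0 dq qd]] := ceil_sqrt d0.
have q2 : 0 < 200 * q%:R ^+ 2 :> R by rewrite mulr_gt0 ?exprn_gt0 ?ltr0n.
pose h := r / (200 * q%:R ^+ 2); have h0 : 0 < h by rewrite divr_gt0.
suff [S [w [b [wr wS far]]]] :
  exists (S : {set 'I_m}) (w : 'cV[R]_d) (b : bool),
    [/\ norm2 w < r,
        if b then w = \sum_(j in S) col j E else S = finset.set0
      & (forall i, h <= norm2 (w - col i E)) \/
        (exists a, h <= norm2 (w - col a E) /\
           forall i, h <= norm2 ((-1) ^+ (i \in S) *: col i E - col a E))].
  have [E' [U' [selU' E'r EE' hE]]] := reflect_hausdorff m0 selU Er wr wS far.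
  by exists E', U'; split=> // _; apply: le_trans hE; exact: ln_rate.
have [[w wr wE]|near] := pselect (exists2 w, norm2 w < r &
    forall i, h <= norm2 (w - col i E)).
  by exists finset.set0, w, false; split=> //; left.
have hr : 200 * q%:R ^+ 2 * h <= r by rewrite /h mulrC (divfK (lt0r_neq0 q2)).
have [|S [a [Sr Sa aS aNS]]] :=
  flip_set (v := fun j => col j E) d0 dq h0 hr.
  move=> x xr; apply: contrapT => /forallNP xE; apply: near; exists x => // i.
  by rewrite norm2B leNgt; apply/negP/xE.
exists S, (\sum_(j in S) col j E), true; split=> //; right; exists a; split=> // i.
by case: (boolP (i \in S)) => iS; rewrite ?scaleN1r ?scale1r; auto.
Qed.
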